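(* Suppose $C=\{\mathbf{x}\in\mathbb{R}^n:(\mathbf{x}-\mathbf{c})^T[I-\epsilon^2\mathbf{v}\mathbf{v}^T](\mathbf{x}-\mathbf{c})=0\}$ is a cone in $\mathbb{R}^n$ centered at $\mathbf{c}=(c_1,\dots,c_n)^T$, with axis vector $\mathbf{v}$ of unit length, eccentricity $\epsilon>1$, and parameters $a$ and $c$, and suppose $H\!P=\{\mathbf{x}\in\mathbb{R}^n:\mathbf{h}\cdot(\mathbf{x}-\mathbf{c})=\hat h\}$ is a hyperplane with $\|\mathbf{h}\|=1$ and $\hat h>0$. Let $\rho=\sqrt{1-(\mathbf{h}\cdot\mathbf{v})^2}$. Then $C\cap H\!P$ is a hyperboloid of dimension $n-1$ if and only if $\epsilon\rho>1$; it is an ellipsoid of dimension $n-1$ if and only if $\epsilon\rho<1$; and it is a paraboloid of dimension $n-1$ if and only if $\epsilon\rho=1$.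
   Context: Norms are Euclidean. The parameters satisfy $0<a<c$ and $\epsilon=c/a$. Conic sections of dimension $n-1$ are taken inside a hyperplane $A$ of $\mathbb{R}^n$: - a hyperboloid (of two sheets) is a set $\{\mathbf{x}\in A: |\,\|\mathbf{q}_2-\mathbf{x}\|-\|\mathbf{q}_1-\mathbf{x}\|\,|=2\alpha\}$ with $\mathbf{q}_1,\mathbf{q}_2\in A$ and $0<2\alpha<\|\mathbf{q}_1-\mathbf{q}_2\|$; - an ellipsoid is a set $\{\mathbf{x}\in A:\|\mathbf{q}_2-\mathbf{x}\|+\|\mathbf{q}_1-\mathbf{x}\|=2\alpha\}$ with $\mathbf{q}_1,\mathbf{q}_2\in A$ (possibly equal), $\alpha>0$ and $2\alpha>\|\mathbf{q}_1-\mathbf{q}_2\|$; - a paraboloid is a set $\{\mathbf{x}\in A:\|\mathbf{q}_1-\mathbf{x}\|=\mathbf{w}\cdot(\mathbf{x}-\mathbf{q}_2)\}$ with $\mathbf{q}_1\neq\mathbf{q}_2$ in $A$ and $\mathbf{w}=(\mathbf{q}_1-\mathbf{q}_2)/\|\mathbf{q}_1-\mathbf{q}_2\|$.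
   Formalization: The case n = 2 is excluded: there the hyperplane is a line, and ellipsoids and hyperboloids in it are both just pairs of distinct points, so the ''only if'' parts for the hyperboloid and the ellipsoid fail (e.g. v = h = e1). *)

(* Defs.v *)
From mathcomp Require Import all_boot all_order all_algebra.
From mathcomp Require Import boolp classical_sets reals.

Set Implicit Arguments.
Unset Strict Implicit.
Unset Printing Implicit Defensive.

Import Order.TTheory GRing.Theory Num.Theory.
Local Open Scope classical_set_scope.
Local Open Scope ring_scope.

Definition dotv (R : realType) (n : nat) (x y : 'cV[R]_n) : R :=
  \sum_(i < n) x i 0 * y i 0.

(* The Euclidean norm; the norm `|x| that MathComp-Analysis puts on matrices
   is the sup norm. *)
Definition enorm (R : realType) (n : nat) (x : 'cV[R]_n) : R :=
  Num.sqrt (dotv x x).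

Definition cone (R : realType) (n : nat) (ctr v : 'cV[R]_n) (eps : R) :
    set 'cV[R]_n :=
  [set x | (x - ctr)^T *m (1%:M - eps ^+ 2 *: (v *m v^T)) *m (x - ctr) = 0].

Definition hyperplane (R : realType) (n : nat) (h p : 'cV[R]_n) (b : R) :
    set 'cV[R]_n :=
  [set x | dotv h (x - p) = b].

Definition is_hyperplane (R : realType) (n : nat) (A : set 'cV[R]_n) : Prop :=
  exists (h p : 'cV[R]_n) (b : R), h <> 0 /\ A = hyperplane h p b.

(* The three predicates below describe conics of dimension n - 1 in R^n: the
   conic lives in some hyperplane A of R^n, which need not pass through 0.

   Pitfall: in R^2, A is a line, and an ellipsoid and a hyperboloid in A are
   both just a pair of distinct points, so is_hyperboloid and is_ellipsoid
   coincide for n = 2. *)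

Definition is_hyperboloid (R : realType) (n : nat) (S : set 'cV[R]_n) : Prop :=
  exists (A : set 'cV[R]_n) (q1 q2 : 'cV[R]_n) (alpha : R),
    [/\ is_hyperplane A, A q1 /\ A q2,
        0 < 2 * alpha /\ 2 * alpha < enorm (q1 - q2)
      & S = [set x | A x /\
               `|enorm (q2 - x) - enorm (q1 - x)| = 2 * alpha]].

(* q1 = q2 is allowed: spheres are ellipsoids. *)
Definition is_ellipsoid (R : realType) (n : nat) (S : set 'cV[R]_n) : Prop :=
  exists (A : set 'cV[R]_n) (q1 q2 : 'cV[R]_n) (alpha : R),
    [/\ is_hyperplane A, A q1 /\ A q2,
        0 < alpha /\ enorm (q1 - q2) < 2 * alpha
      & S = [set x | A x /\
               enorm (q2 - x) + enorm (q1 - x) = 2 * alpha]].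

Definition is_paraboloid (R : realType) (n : nat) (S : set 'cV[R]_n) : Prop :=
  exists (A : set 'cV[R]_n) (q1 q2 : 'cV[R]_n),
    let w := (enorm (q1 - q2))^-1 *: (q1 - q2) in
    [/\ is_hyperplane A, A q1 /\ A q2, q1 <> q2
      & S = [set x | A x /\ enorm (q1 - x) = dotv w (x - q2)]].

(* Main.v *)
(* For [x - ctr] in the cutting hyperplane put [p = v - (h . v) h] and
   [k = 1 - eps^2 rho^2].  If [k] is not 0, completing the square along [p] turns
   the cone equation into (y.F)^2 = al^2 (|y|^2 + |F|^2 - al^2), where
   al = hhat sqrt(eps^2 - 1) / |k|, F = eps al p and y is the position relative
   to the midpoint of the foci.  This is the common squared form of
   | |y + F| - |y - F| | = 2 al (if al < |F|) and |y + F| + |y - F| = 2 al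
   (if |F| < al), and |F| / al = eps rho.  If [k = 0], the cone equation is a
   focus-directrix equation with axis along [p].

   For the converses the three types of conics have to be mutually exclusive.
   For n > 2, ellipsoids are bounded while the other two types are not;
   hyperboloids are centrally symmetric, but a centrally symmetric paraboloid
   would be bounded.  For n = 1 the hyperplane is a point, so hyperboloids and
   paraboloids do not exist, and the empty set is an ellipsoid. *)
Require Import Defs.
From mathcomp Require Import all_boot all_order all_algebra.
From mathcomp Require Import boolp classical_sets reals.
From mathcomp Require Import ring lra.
Import Order.TTheory GRing.Theory Num.Theory.
Local Open Scope classical_set_scope.
Local Open Scope ring_scope.

(** * Euclidean geometry and the squared form of two-focus equations *)

Section DotProduct.
Context {R : realType} {n : nat}.
Implicit Types (x y z F : 'cV[R]_n) (a : R).

Lemma dotvC x y : dotv x y = dotv y x.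
Proof. by apply: eq_bigr => i _; rewrite mulrC. Qed.

Lemma dotvDl x y z : dotv (x + y) z = dotv x z + dotv y z.
Proof. by rewrite -big_split; apply: eq_bigr => i _; rewrite mxE mulrDl. Qed.

Lemma dotvZl a x y : dotv (a *: x) y = a * dotv x y.
Proof. by rewrite [RHS]mulr_sumr; apply: eq_bigr => i _; rewrite mxE mulrA. Qed.

Lemma dotvNl x y : dotv (- x) y = - dotv x y.
Proof. by rewrite -scaleN1r dotvZl mulN1r. Qed.

Lemma dotvDr x y z : dotv z (x + y) = dotv z x + dotv z y.
Proof. by rewrite dotvC dotvDl !(dotvC z). Qed.

Lemma dotvZr a x y : dotv x (a *: y) = a * dotv x y.
Proof. by rewrite dotvC dotvZl dotvC. Qed.

Lemma dotvNr x y : dotv x (- y) = - dotv x y.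
Proof. by rewrite dotvC dotvNl dotvC. Qed.

Definition dotv_lin := (dotvDl, dotvDr, dotvZl, dotvZr, dotvNl, dotvNr).

Lemma dotv_ge0 x : 0 <= dotv x x.
Proof. by apply: sumr_ge0 => i _; rewrite -expr2 sqr_ge0. Qed.

Lemma dotv_eq0 x : (dotv x x == 0) = (x == 0).
Proof.
apply/eqP/eqP => [/eqP|->]; last by apply: big1 => i _; rewrite mxE mul0r.
rewrite psumr_eq0 => [/allP x0|i _]; last by rewrite -expr2 sqr_ge0.
apply/matrixP => i j; rewrite (ord1 j) mxE; apply/eqP.
by have := x0 i (mem_index_enum i); rewrite -expr2 sqrf_eq0.
Qed.

Lemma dotv_CauchySchwarz x y : dotv x y ^+ 2 <= dotv x x * dotv y y.
Proof.
have [y0|y0] := eqVneq y 0.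
  by rewrite {1}y0 -(scale0r 0) dotvZr mul0r expr0n mulr_ge0 ?dotv_ge0.
have yy : 0 < dotv y y by rewrite lt_def dotv_eq0 y0 dotv_ge0.
(* This vector is |y|^2 times the component of [x] orthogonal to [y]. *)
have := dotv_ge0 (dotv y y *: x - dotv x y *: y).
rewrite !dotv_lin (dotvC y x) => H.
rewrite -subr_ge0 -(pmulr_rge0 _ yy).
by apply: le_trans H _; rewrite le_eqVlt; apply/orP; left; apply/eqP; ring.
Qed.

Lemma enorm_ge0 x : 0 <= enorm x.
Proof. exact: sqrtr_ge0. Qed.

Lemma enorm_sqr x : enorm x ^+ 2 = dotv x x.
Proof. by rewrite sqr_sqrtr ?dotv_ge0. Qed.

(** Parallelogram law for [x - m] and [m], with the square of |x - 2m| dropped. *)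
Lemma dotv_subl_le x m : dotv x x <= 2 * dotv (x - m) (x - m) + 2 * dotv m m.
Proof.
have := dotv_ge0 (x - m - m); rewrite !dotv_lin (dotvC m x); lra.
Qed.

(* The matrix with columns [x] and [y] has rank at most 2, hence a nonzero row
   kernel. *)
Lemma orthogonal_unit_exists x y : (2 < n)%N ->
  exists z, [/\ dotv z z = 1, dotv x z = 0 & dotv y z = 0].
Proof.
move=> n3; set M := row_mx x y.
have : kermx M != 0.
  by rewrite kermx_eq0 /row_free neq_ltn (leq_ltn_trans (rank_leq_col M)).
case/rowV0Pn => u /sub_kermxP; rewrite mul_mx_row => /eqP uM u0.
move: uM; rewrite -(row_mx0 _ 1 1 1) => /eqP /eq_row_mx [ux uy].
have dotu w : u *m w = 0 -> dotv w u^T = 0.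
  move=> /matrixP/(_ 0 0); rewrite !mxE => uw.
  by rewrite -uw; apply: eq_bigr => i _; rewrite mxE mulrC.
have uu : 0 < dotv u^T u^T.
  by rewrite lt_def dotv_ge0 dotv_eq0 trmx_eq0 u0.
exists ((enorm u^T)^-1 *: u^T); rewrite !dotv_lin (dotu _ ux) (dotu _ uy) !mulr0.
split=> //; rewrite mulrA -expr2 exprVn enorm_sqr mulVf //.
by rewrite gt_eqF.
Qed.

(** The squared sum and difference of the focal distances depend only on these two quantities, both
    polynomial in [x - m] and [F]. *)
Lemma bifocal_sqr x m F :
  [/\ enorm (m + F - x) ^+ 2 + enorm (m - F - x) ^+ 2 =
        2 * (dotv (x - m) (x - m) + dotv F F)
    & (enorm (m + F - x) * enorm (m - F - x)) ^+ 2 =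
        (dotv (x - m) (x - m) + dotv F F) ^+ 2 - 4 * dotv (x - m) F ^+ 2].
Proof.
rewrite exprMn !enorm_sqr.
have -> : m + F - x = F - (x - m) by rewrite opprB addrA [m + F]addrC.
have -> : m - F - x = - F - (x - m) by rewrite opprB addrA [m - F]addrC.
move: (x - m) => y; rewrite !dotv_lin (dotvC F y).
by split; ring.
Qed.

(** Squaring once determines the product of the focal distances; squaring that product removes all
    roots. Going back, Cauchy-Schwarz supplies the sign needed to take roots. *)
Lemma bifocal_hyperboloid x m F al : 0 < al -> al ^+ 2 < dotv F F ->
  `|enorm (m - F - x) - enorm (m + F - x)| = 2 * al <->
  dotv (x - m) F ^+ 2 =
    al ^+ 2 * (dotv (x - m) (x - m) + dotv F F - al ^+ 2).
Proof.
move=> al0 alF; have [] := bifocal_sqr x m F.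
have := enorm_ge0 (m + F - x); have := enorm_ge0 (m - F - x).
have := dotv_CauchySchwarz (x - m) F; have := dotv_ge0 (x - m).
move: (enorm (m - F - x)) (enorm (m + F - x)) alF => Q P.
move: (dotv _ (x - m)) (dotv _ F) (dotv F F) => Y D f alF Y0 CS Q0 P0 sumE prodE.
have PQ0 : 0 <= P * Q by rewrite mulr_ge0.
split=> [E|E].
  have {}E : (Q - P) ^+ 2 = 4 * al ^+ 2.
    by rewrite -real_normK ?num_real // E; ring.
  have PQ : P * Q = Y + f - 2 * al ^+ 2.
    by move: E sumE; rewrite sqrrB => ? ?; lra.
  move: prodE; rewrite PQ => ?; lra.
(* Otherwise the positive product below gives al^2 (Y + f - al^2) > f Y, so D^2 > f Y, against
   Cauchy-Schwarz. *)
have Yal : al ^+ 2 <= Y.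
  rewrite leNgt; apply/negP => Yal.
  have : 0 < (f - al ^+ 2) * (al ^+ 2 - Y) by rewrite mulr_gt0 ?subr_gt0.
  move: CS; rewrite E => ? ?; lra.
have PQ : P * Q = Y + f - 2 * al ^+ 2.
  apply/eqP; rewrite -(@eqrXn2 _ 2) ?prodE ?E //; last by lra.
  by apply/eqP; ring.
apply/eqP; rewrite -(@eqrXn2 _ 2) ?normr_ge0 //; last by lra.
rewrite real_normK ?num_real //; apply/eqP; rewrite sqrrB; lra.
Qed.

Lemma bifocal_ellipsoid x m F al : 0 < al -> dotv F F < al ^+ 2 ->
  enorm (m - F - x) + enorm (m + F - x) = 2 * al <->
  dotv (x - m) F ^+ 2 =
    al ^+ 2 * (dotv (x - m) (x - m) + dotv F F - al ^+ 2).
Proof.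
move=> al0 alF; have [] := bifocal_sqr x m F.
have := enorm_ge0 (m + F - x); have := enorm_ge0 (m - F - x).
have := dotv_CauchySchwarz (x - m) F; have := dotv_ge0 (x - m).
move: (enorm (m - F - x)) (enorm (m + F - x)) alF => Q P.
move: (dotv _ (x - m)) (dotv _ F) (dotv F F) => Y D f alF Y0 CS Q0 P0 sumE prodE.
have PQ0 : 0 <= P * Q by rewrite mulr_ge0.
split=> [E|E].
  have {}E : (Q + P) ^+ 2 = 4 * al ^+ 2 by rewrite E; ring.
  have PQ : P * Q = 2 * al ^+ 2 - Y - f.
    by move: E sumE; rewrite sqrrD => ? ?; lra.
  move: prodE; rewrite PQ => ?; lra.
(* Same contradiction with Cauchy-Schwarz, with both factors of the product reversed in sign. *)
have Yal : Y <= al ^+ 2.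
  rewrite leNgt; apply/negP => Yal.
  have : 0 < (al ^+ 2 - f) * (Y - al ^+ 2) by rewrite mulr_gt0 ?subr_gt0.
  move: CS; rewrite E => ? ?; lra.
have PQ : P * Q = 2 * al ^+ 2 - Y - f.
  apply/eqP; rewrite -(@eqrXn2 _ 2) ?prodE ?E //; last by lra.
  by apply/eqP; ring.
apply/eqP; rewrite -(@eqrXn2 _ 2) ?addr_ge0 //; last by lra.
apply/eqP; rewrite sqrrD; lra.
Qed.

End DotProduct.

(** * Boundedness and central symmetry of the three types *)

Section ConicShapes.
Set Implicit Arguments.
Unset Strict Implicit.
Context {R : realType} {n : nat}.
Implicit Types (S A : set 'cV[R]_n) (h p q x m F : 'cV[R]_n).

Definition sq_bounded S := exists M, forall x, S x -> dotv x x <= M.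

Definition centrally_symmetric S := exists m, forall x, S x -> S (2 *: m - x).

Lemma sq_bounded_translate m S :
  sq_bounded S <-> exists M, forall x, S x -> dotv (x - m) (x - m) <= M.
Proof.
split=> -[M bM]; exists (2 * M + 2 * dotv m m) => x /bM {}bM.
  by have := dotv_ge0 (x + m); rewrite !dotv_lin (dotvC m x); lra.
by have := dotv_subl_le x m; lra.
Qed.

Lemma hyperplaneE h p b x : hyperplane h p b x ->
  forall y, hyperplane h p b y <-> dotv h (y - x) = 0.
Proof. move=> + y; by rewrite /hyperplane /= !dotv_lin => <-; split; lra. Qed.

Lemma midpoint_foci q1 q2 : exists m F, q1 = m + F /\ q2 = m - F.
Proof.
exists (2^-1 *: (q1 + q2)), (2^-1 *: (q1 - q2)).
by split; apply/matrixP => i j; rewrite !mxE; lra.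
Qed.

Lemma enorm_focal m F : enorm (m + F - (m - F)) = 2 * enorm F.
Proof.
have -> : m + F - (m - F) = 2 *: F.
  by apply/matrixP => i j; rewrite !mxE; lra.
rewrite /enorm !dotv_lin mulrA -expr2 sqrtrM ?sqr_ge0 //.
by rewrite sqrtr_sqr ger0_norm.
Qed.

Lemma hyperplane_foci h p b m F :
  hyperplane h p b (m + F) -> hyperplane h p b (m - F) ->
  hyperplane h p b m /\ dotv h F = 0.
Proof. by rewrite /hyperplane /= !dotv_lin; split; lra. Qed.

Lemma ellipsoid_bounded S : is_ellipsoid S -> sq_bounded S.
Proof.
case=> A [q1 [q2 [al [_ _ [al0 _] ->]]]].
apply/(sq_bounded_translate q1); exists ((2 * al) ^+ 2) => x [_ E].
have := enorm_sqr (q1 - x); have := enorm_ge0 (q1 - x).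
have := enorm_ge0 (q2 - x); rewrite !dotv_lin (dotvC x q1).
move: (enorm (q1 - x)) (enorm (q2 - x)) E => P Q E Q0 P0.
have : 0 <= (2 * al - P) * (2 * al + P) by apply: mulr_ge0; lra.
lra.
Qed.

(** Root-free form centered at the midpoint of the foci: symmetry and membership of explicit points
    become algebra. *)
Lemma hyperboloid_bifocal S : is_hyperboloid S ->
  exists h p b m F al,
    [/\ hyperplane h p b m, dotv h F = 0, 0 < al, al ^+ 2 < dotv F F &
      S = [set x | hyperplane h p b x /\ dotv (x - m) F ^+ 2 =
             al ^+ 2 * (dotv (x - m) (x - m) + dotv F F - al ^+ 2)]].
Proof.
case=> _ [q1 [q2 [al [[h [p [b [_ ->]]]] [A1 A2] [al0 al1] ->]]]].
have [m [F [q1E q2E]]] := midpoint_foci q1 q2.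
move: A1 A2 al1; rewrite {}q1E {}q2E enorm_focal => A1 A2 al1.
have [Am hF] := hyperplane_foci A1 A2.
have alF : al ^+ 2 < dotv F F.
  by rewrite -enorm_sqr ltr_sqr ?nnegrE ?enorm_ge0 //; lra.
exists h, p, b, m, F, al; split=> //; first lra.
apply/seteqP; split=> x /= [Ax E]; split=> //.
  by apply/bifocal_hyperboloid => //; lra.
by apply/bifocal_hyperboloid => //; lra.
Qed.

Lemma hyperboloid_symmetric S : is_hyperboloid S -> centrally_symmetric S.
Proof.
case/hyperboloid_bifocal => h [p [b [m [F [al [Am hF al0 alF ->]]]]]].
exists m => x [/(hyperplaneE Am) Ax E].
have xm : 2 *: m - x - m = - (x - m).
  by apply/matrixP => i j; rewrite !mxE; lra.
split; first by apply/(hyperplaneE Am); rewrite xm dotvNr Ax oppr0.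
by rewrite xm !(dotvNl, dotvNr) sqrrN opprK.
Qed.

(** In dimension above 2 there is a direction [z] inside the hyperplane orthogonal to the focal
    axis; points with arbitrarily large [z] component exist. *)
Lemma hyperboloid_unbounded S : (2 < n)%N -> is_hyperboloid S -> ~ sq_bounded S.
Proof.
move=> n3 /hyperboloid_bifocal [h [p [b [m [F [al [Am hF al0 alF ->]]]]]]].
have [z [zz hz Fz]] := orthogonal_unit_exists h F n3.
move=> /(sq_bounded_translate m) [M bM].
pose r := 1 + `|M|.
have F0 : 0 < dotv F F by apply: lt_trans alF; rewrite exprn_gt0.
(* Solution for a^2 of the bifocal equation at y = a F + r z. *)
pose a2 := al ^+ 2 * (r ^+ 2 + dotv F F - al ^+ 2)
           / (dotv F F * (dotv F F - al ^+ 2)).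
have a2_ge0 : 0 <= a2.
  apply: divr_ge0; last by rewrite mulr_ge0; lra.
  by rewrite mulr_ge0 ?sqr_ge0 // -addrA addr_ge0 ?sqr_ge0 //; lra.
have a2E : a2 * (dotv F F * (dotv F F - al ^+ 2)) =
    al ^+ 2 * (r ^+ 2 + dotv F F - al ^+ 2).
  by rewrite divfK // mulf_neq0 ?gt_eqF // subr_gt0.
have [a aE] : exists a, a ^+ 2 = a2 by exists (Num.sqrt a2); rewrite sqr_sqrtr.
have := bM (m + (a *: F + r *: z)).
set y := a *: F + r *: z.
have -> : m + y - m = y by rewrite addrC addKr.
have yF : dotv y F = a * dotv F F by rewrite !dotv_lin (dotvC z) Fz; ring.
have yy : dotv y y = a2 * dotv F F + r ^+ 2.
  by rewrite !dotv_lin (dotvC z F) Fz zz -aE; ring.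
rewrite yy => H.
have {H} : a2 * dotv F F + r ^+ 2 <= M.
  apply: H; split.
    apply/(hyperplaneE Am); rewrite addrC addKr !dotv_lin hF hz; ring.
  have -> : m + y - m = y by rewrite addrC addKr.
  rewrite yF yy exprMn aE; apply/eqP; rewrite -subr_eq0; apply/eqP.
  rewrite -[RHS](subrr (a2 * (dotv F F * (dotv F F - al ^+ 2)))) {2}a2E; ring.
have : 0 <= a2 * dotv F F by rewrite mulr_ge0 // ltW.
have := ler_norm M; have := normr_ge0 M; have := sqr_ge0 (`|M|); rewrite /r sqrrD; lra.
Qed.

(** Recentered at the focus [q]: [w] is the unit axis and [d] the distance from focus to
    directrix. *)
Lemma paraboloid_directrix S : is_paraboloid S ->
  exists h p b q w d,
    [/\ hyperplane h p b q, dotv h w = 0, dotv w w = 1, 0 < d &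
      S = [set x | hyperplane h p b x /\ enorm (q - x) = dotv w (x - q) + d]].
Proof.
case=> _ [q1 [q2 /= [[h [p [b [_ ->]]]] [A1 A2] /eqP q12 ->]]].
set d := enorm (q1 - q2); set w := d^-1 *: (q1 - q2).
have d0 : 0 < d.
  by rewrite lt_def enorm_ge0 -sqrf_eq0 enorm_sqr dotv_eq0 subr_eq0 q12.
have dd : dotv (q1 - q2) (q1 - q2) = d ^+ 2 by rewrite enorm_sqr.
have wq : dotv w (q1 - q2) = d by rewrite dotvZl dd expr2 mulKf ?gt_eqF.
exists h, p, b, q1, w, d; split=> //.
- by rewrite dotvZr (proj1 (hyperplaneE A2 _) A1) mulr0.
- by rewrite dotvZr wq mulVf ?gt_eqF.
apply/seteqP; split=> x /= [Ax ->]; split=> //.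
  by rewrite -[in RHS]wq -dotvDr subrKA.
by rewrite -[in LHS]wq -dotvDr subrKA.
Qed.

(** The focal distance is affine on the paraboloid, so its values at [x] and at the reflected point
    have the constant sum [e]. Both are nonnegative, hence at most [e]. *)
Lemma paraboloid_symmetric_bounded S :
  is_paraboloid S -> centrally_symmetric S -> sq_bounded S.
Proof.
case/paraboloid_directrix => h [p [b [q [w [d [Aq hw ww d0 ->]]]]]] [m sym].
apply/(sq_bounded_translate q).
pose e := 2 * dotv w (m - q) + 2 * d.
exists (e ^+ 2) => x /[dup] /sym[_ E'] [_ E].
have := enorm_ge0 (q - (2 *: m - x)); have := enorm_ge0 (q - x).
have : dotv (x - q) (x - q) = enorm (q - x) ^+ 2.
  by rewrite enorm_sqr !dotv_lin; ring.
rewrite {}E' E => -> P0 Q0; rewrite ler_sqr ?nnegrE //.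
all: move: P0 Q0; rewrite /e !dotv_lin; lra.
Qed.

Lemma paraboloid_unbounded S : (2 < n)%N -> is_paraboloid S -> ~ sq_bounded S.
Proof.
move=> n3 /paraboloid_directrix [h [p [b [q [w [d [Aq hw ww d0 ->]]]]]]].
have [z [zz hz wz]] := orthogonal_unit_exists h w n3.
move=> /(sq_bounded_translate q) [M bM].
pose r := 1 + `|M|.
(* Solves |a w + r z| = a + d after squaring: a^2 + r^2 = (a + d)^2. *)
pose a := (r ^+ 2 - d ^+ 2) / (2 * d).
have ad : 2 * (a * d) = r ^+ 2 - d ^+ 2.
  by rewrite mulrCA divfK // mulf_neq0 ?gt_eqF.
pose y := a *: w + r *: z.
have yy : dotv y y = a ^+ 2 + r ^+ 2.
  by rewrite !dotv_lin (dotvC z w) wz zz ww; ring.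
have yq : q + y - q = y by rewrite addrC addKr.
have ad0 : 0 <= a + d.
  rewrite -(pmulr_rge0 _ d0); have := sqr_ge0 r; have := sqr_ge0 d; lra.
have := bM (q + y); rewrite yq yy => H.
have {H} : a ^+ 2 + r ^+ 2 <= M.
  apply: H; split.
    by apply/(hyperplaneE Aq); rewrite yq !dotv_lin hw hz; ring.
  rewrite yq !dotv_lin ww wz mulr1 mulr0 addr0.
  rewrite -(ger0_norm ad0) -sqrtr_sqr; congr Num.sqrt.
  rewrite opprD addNKr.
  by rewrite !(dotvNl, dotvNr) opprK yy; move: ad; clearbody a r; lra.
have := sqr_ge0 a.
have := ler_norm M; have := normr_ge0 M; have := sqr_ge0 (`|M|); rewrite /r sqrrD; lra.
Qed.

Lemma hyperplane_dim1 h p b x y : n = 1%N -> h <> 0 ->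
  hyperplane h p b x -> hyperplane h p b y -> x = y.
Proof.
move=> n1 /eqP + /hyperplaneE Ax /Ax; rewrite -dotv_eq0.
move: n1 h x y {Ax} => -> h x y; rewrite /dotv !big_ord1 mulf_eq0 orbb => h0.
rewrite !mxE => /eqP; rewrite mulf_eq0 (negPf h0) subr_eq0 => /eqP yx.
by apply/matrixP => i j; rewrite !ord1.
Qed.

Lemma hyperboloid_dim_neq1 S : is_hyperboloid S -> n <> 1%N.
Proof.
case=> _ [q1 [q2 [al [[h [p [b [h0 ->]]]] [A1 A2] [al0 al1] _]]]] n1.
move: al1; rewrite (hyperplane_dim1 n1 h0 A1 A2) subrr.
rewrite -(scale0r 0) /enorm dotvZl mul0r sqrtr0; lra.
Qed.

Lemma paraboloid_dim_neq1 S : is_paraboloid S -> n <> 1%N.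
Proof.
case=> _ [q1 [q2 /= [[h [p [b [h0 ->]]]] [A1 A2] q12 _]]] n1.
exact/q12/(hyperplane_dim1 n1 h0 A1 A2).
Qed.

End ConicShapes.

(** * Sections of the cone in the cases [k != 0] and [k = 0] *)

Section ConeSection.
Set Implicit Arguments.
Unset Strict Implicit.
Context {R : realType} {n : nat}.
Implicit Types (h v p q x m F ctr : 'cV[R]_n) (e b : R).

Lemma coneE ctr v e x :
  cone ctr v e x <-> dotv (x - ctr) (x - ctr) = e ^+ 2 * dotv v (x - ctr) ^+ 2.
Proof.
have mulE (y z : 'cV[R]_n) : y^T *m z = (dotv y z)%:M.
  apply/matrixP => i j; rewrite !ord1 !mxE.
  by apply: eq_bigr => l _; rewrite mxE.
rewrite /cone /=; move: (x - ctr) => y.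
have -> : y^T *m (1%:M - e ^+ 2 *: (v *m v^T)) *m y =
    (dotv y y - e ^+ 2 * dotv v y ^+ 2)%:M.
  rewrite mulmxBr mulmx1 mulmxBl (mulE y y) -scalemxAr -scalemxAl.
  rewrite (mulmxA y^T v) -(mulmxA (y^T *m v)) (mulE y v) (mulE v y).
  by rewrite -scalar_mxM scale_scalar_mx (dotvC y v) -expr2 raddfB.
split=> [/matrixP/(_ 0 0)|yE].
  by rewrite !mxE => /subr0_eq.
by rewrite yE subrr raddf0.
Qed.

(* Completing the square in the direction of [F] turns the cone equation into
   the bifocal one; here [1 - k] is the squared eccentricity of the conic. *)
Lemma cone_section_bifocal ctr v h e b : dotv v v = 1 -> dotv h h = 1 ->
    1 < e -> 0 < b ->
  let k := 1 - e ^+ 2 * (1 - dotv h v ^+ 2) in k != 0 ->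
  exists m F al,
    [/\ hyperplane h ctr b m, dotv h F = 0, 0 < al,
        dotv F F = (1 - k) * al ^+ 2 &
      cone ctr v e `&` hyperplane h ctr b =
        [set x | hyperplane h ctr b x /\ dotv (x - m) F ^+ 2 =
           al ^+ 2 * (dotv (x - m) (x - m) + dotv F F - al ^+ 2)]].
Proof.
move=> vv hh e1 b0; set t := dotv h v => k k0.
(* [b *: h] is the foot of the perpendicular from [ctr] to the hyperplane; [sg] is the shift along
   [p] that cancels the linear term of the cone equation. *)
pose p := v - t *: h; pose sg := e ^+ 2 * b * t / k.
pose al := b * Num.sqrt (e ^+ 2 - 1) / `|k|.
have e21 : 0 < e ^+ 2 - 1 by rewrite subr_gt0 expr_gt1 // ltW // (lt_trans ltr01).
have al0 : 0 < al.
  by rewrite divr_gt0 ?normr_gt0 // mulr_gt0 ?sqrtr_gt0.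
have alE : al ^+ 2 = b ^+ 2 * (e ^+ 2 - 1) / k ^+ 2.
  by rewrite !exprMn exprVn real_normK ?num_real // sqr_sqrtr // ltW.
have hp : dotv h p = 0 by rewrite !dotv_lin hh -/t; ring.
have pp : dotv p p = 1 - t ^+ 2.
  by rewrite !dotv_lin hh vv (dotvC v h) -/t; ring.
have yp0 y : dotv y p = dotv v y - t * dotv h y.
  by rewrite !dotv_lin (dotvC y v) (dotvC y h); ring.
clearbody p; exists (ctr + b *: h + sg *: p), (e * al *: p), al.
set m := ctr + b *: h + sg *: p.
have mE x : x - m = (x - ctr) - b *: h - sg *: p by rewrite !opprD !addrA.
split=> //.
- by rewrite /hyperplane /= /m addrAC [X in X + _]addrAC subrr add0r !dotv_lin hp hh; ring.
- by rewrite dotvZr hp mulr0.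
- by rewrite !dotv_lin pp /k; ring.
suff key x : hyperplane h ctr b x -> cone ctr v e x <->
    dotv (x - m) (e * al *: p) ^+ 2 =
    al ^+ 2 * (dotv (x - m) (x - m) + dotv (e * al *: p) (e * al *: p) - al ^+ 2).
  by apply/seteqP; split=> x /= [] ? ?; split=> //; apply/key.
move=> hx; apply: (iff_trans (coneE _ _ _ _)).
rewrite mE; move: hx; rewrite /hyperplane /=; move: (x - ctr) => y hy.
have yp : dotv y p = dotv v y - t * b by rewrite yp0 hy.
set V := dotv v y in yp *.
have sgk : sg * k = e ^+ 2 * b * t by rewrite divfK.
have kE : k = 1 - e ^+ 2 * (1 - t ^+ 2) by [].
have sgE : e ^+ 2 * (t * b + sg * (1 - t ^+ 2)) = sg.
  by apply/eqP; rewrite -subr_eq0; apply/eqP; move: sgk; rewrite kE; lra.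
(* The right-hand side is the value of e^2 (v . y)^2 - |y|^2 at the center y = b h + sg p. *)
have al2k : k * al ^+ 2 = b * (sg * t - b).
  apply: (mulfI k0).
  have -> : k * (k * al ^+ 2) = b ^+ 2 * (e ^+ 2 - 1) by rewrite alE; field.
  have -> : k * (b * (sg * t - b)) = b * (sg * k * t - b * k) by ring.
  by rewrite sgk kE; ring.
clearbody k sg al t.
have -> : dotv (y - b *: h - sg *: p) (e * al *: p) =
    e * al * (V - t * b - sg * (1 - t ^+ 2)).
  by rewrite dotvZr !(dotvDl, dotvNl, dotvZl) yp hp pp; ring.
have -> : dotv (y - b *: h - sg *: p) (y - b *: h - sg *: p) =
    dotv y y - b ^+ 2 - 2 * sg * (V - t * b) + sg ^+ 2 * (1 - t ^+ 2).
  rewrite !(dotvDl, dotvNl, dotvZl, dotvDr, dotvNr, dotvZr).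
  by rewrite (dotvC p y) (dotvC p h) (dotvC y h) yp hy hp hh pp; ring.
have -> : dotv (e * al *: p) (e * al *: p) = e ^+ 2 * al ^+ 2 * (1 - t ^+ 2).
  by rewrite dotvZl dotvZr pp; ring.
set Y := dotv y y.
have al20 : al ^+ 2 != 0 by rewrite expf_neq0 ?gt_eqF.
(* the two equations differ by the factor [al ^+ 2] *)
have E : al ^+ 2 * (e ^+ 2 * V ^+ 2 - Y) =
    (e * al * (V - t * b - sg * (1 - t ^+ 2))) ^+ 2 -
    al ^+ 2 * (Y - b ^+ 2 - 2 * sg * (V - t * b) + sg ^+ 2 * (1 - t ^+ 2) +
       e ^+ 2 * al ^+ 2 * (1 - t ^+ 2) - al ^+ 2).
  (* The identity holds only modulo [sgE] and [al2k]; the required combination of them is inserted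
     as a zero. *)
  rewrite -[LHS]addr0 -[X in _ + X](mulr0 (al ^+ 2)).
  have -> : 0 = - (2 * V - (t * b + sg * (1 - t ^+ 2))) *
        (e ^+ 2 * (t * b + sg * (1 - t ^+ 2)) - sg) +
      (k * al ^+ 2 - b * (sg * t - b)) by rewrite al2k sgE !subrr mulr0 addr0.
  by rewrite kE; ring.
split=> [YE|/eqP].
  by apply: subr0_eq; rewrite -E YE subrr mulr0.
by rewrite -subr_eq0 -E mulf_eq0 (negPf al20) subr_eq0 => /eqP.
Qed.

Lemma cone_section_paraboloid ctr v h e b : dotv v v = 1 -> dotv h h = 1 ->
    1 < e -> 0 < b -> e ^+ 2 * (1 - dotv h v ^+ 2) = 1 ->
  is_paraboloid (cone ctr v e `&` hyperplane h ctr b).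
Proof.
move=> vv hh e1 b0; set t := dotv h v => et.
have e0 : 0 < e by exact: lt_trans e1.
have t0 : t != 0.
  apply: contraTneq e1 => t0; move: et; rewrite t0 -leNgt.
  by rewrite expr0n subr0 mulr1 => e2; rewrite -(@expr_le1 _ 2) ?e2 // ltW.
(* The sign [tau] orients the axis [w] so that the directrix distance [d] is positive. [w] is a unit
   vector because |v - t h| = rho = 1 / e. *)
pose tau := Num.sg t.
have tau2 : tau ^+ 2 = 1 by rewrite sqr_sg t0.
have tt : 0 < `|t| by rewrite normr_gt0.
pose w := (tau * e) *: (v - t *: h).
(* [be] places the focus on the axis through the foot [ctr + b *: h]; its value makes the constant
   terms of |z|^2 and (w . z + d)^2 agree. *)
pose d := e * `|t| * b; pose be := b ^+ 2 / (2 * d).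
have d0 : 0 < d by rewrite !mulr_gt0.
have bed : 2 * be * d = b ^+ 2 by rewrite mulrAC mulrC divfK ?mulf_neq0 ?gt_eqF.
have hw : dotv h w = 0 by rewrite !dotv_lin hh -/t; ring.
have ww : dotv w w = 1.
  rewrite dotvZl dotvZr !dotv_lin hh vv (dotvC v h) -/t.
  transitivity (tau ^+ 2 * (e ^+ 2 * (1 - t ^+ 2))); first by ring.
  by rewrite tau2 et mulr1.
have yw y : dotv w y = tau * e * (dotv v y - t * dotv h y).
  by rewrite dotvZl !dotv_lin.
clearbody w; exists (hyperplane h ctr b).
pose q := ctr + b *: h + be *: w.
exists q, (q - d *: w).
have wE : (enorm (q - (q - d *: w)))^-1 *: (q - (q - d *: w)) = w.
  rewrite subKr /enorm dotvZl dotvZr ww mulr1 -expr2 sqrtr_sqr gtr0_norm //.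
  by rewrite scalerA mulVf ?scale1r ?gt_eqF.
have hq : hyperplane h ctr b q.
  by rewrite /hyperplane /= /q addrAC [X in X + _]addrAC subrr add0r dotvDr !dotvZr hw hh; ring.
rewrite wE; split.
- exists h, ctr, b; split=> // h0.
  by move: hh; rewrite h0 -(scale0r 0) dotvZl mul0r => /eqP; rewrite eq_sym oner_eq0.
- split=> //; apply/(hyperplaneE hq).
  by rewrite addrAC subrr add0r dotvNr dotvZr hw mulr0 oppr0.
- move=> /eqP; rewrite -subr_eq0 subKr -dotv_eq0 dotvZl dotvZr ww.
  by rewrite mulr1 mulf_eq0 orbb gt_eqF.
suff key x : hyperplane h ctr b x -> cone ctr v e x <->
    enorm (q - x) = dotv w (x - (q - d *: w)).
  by apply/seteqP; split=> x /= [] ? ?; split=> //; apply/key.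
move=> hx; apply: (iff_trans (coneE _ _ _ _)).
have -> : x - (q - d *: w) = (x - q) + d *: w by rewrite opprB addrA addrAC.
rewrite (dotvDr _ (d *: w)) dotvZr ww mulr1.
have -> : enorm (q - x) = enorm (x - q).
  by rewrite /enorm -[q - x]opprB dotvNl dotvNr opprK.
have -> : x - q = (x - ctr) - b *: h - be *: w by rewrite !opprD !addrA.
move: hx; rewrite /hyperplane /=; move: (x - ctr) => y hy.
set z := y - b *: h - be *: w.
set V := dotv v y.
have wy : dotv w y = tau * e * (V - t * b) by rewrite yw hy.
have wz : dotv w z = dotv w y - be.
  by rewrite !(dotvDr, dotvNr) !dotvZr ww (dotvC w h) hw; ring.
have zz : dotv z z = dotv y y - b ^+ 2 - 2 * be * dotv w y + be ^+ 2.
  rewrite !(dotvDl, dotvNl, dotvZl, dotvDr, dotvNr, dotvZr).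
  by rewrite (dotvC y w) (dotvC y h) (dotvC w h) hy hw hh ww; ring.
(* Up to the sign [tau], e (v . y) is the affine function w . y + d, so the cone equation reads
   |y|^2 = (w . y + d)^2. *)
have eV : e ^+ 2 * V ^+ 2 = (dotv w y + d) ^+ 2.
  have -> : dotv w y + d = tau * (e * V).
    by rewrite wy /d (normrEsg t) -/tau; ring.
  by rewrite !exprMn tau2 mul1r.
have CS := dotv_CauchySchwarz w z; rewrite ww mul1r in CS.
move: (enorm_ge0 z) (enorm_sqr z); move: (enorm z) => N N0 N2.
rewrite eV; split=> E.
  have NE : dotv z z = (dotv w z + d) ^+ 2.
    rewrite zz wz E; move: bed; clearbody be d; lra.
  apply/eqP; rewrite -(@eqrXn2 _ 2) ?N2 ?NE //.
  (* Cauchy-Schwarz gives (w . z)^2 <= (w . z + d)^2, so 2 d (w . z) + d^2 >= 0 and w . z + d cannot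
     be negative. *)
  by rewrite -(pmulr_rge0 _ d0); move: CS; rewrite NE; have := sqr_ge0 d; lra.
move: N2; rewrite E zz wz; move: bed; clearbody be d; lra.
Qed.

End ConeSection.

(** * Mutual exclusion of the three types *)

Section ConicTypes.
Set Implicit Arguments.
Unset Strict Implicit.
Context {R : realType} {n : nat}.
Implicit Types (S : set 'cV[R]_n).

Lemma not_hyperboloid_ellipsoid S : n = 1%N \/ (2 < n)%N ->
  is_hyperboloid S -> ~ is_ellipsoid S.
Proof.
move=> n13 hS /ellipsoid_bounded; case: n13 => n1.
  by case: (hyperboloid_dim_neq1 hS n1).
exact: hyperboloid_unbounded.
Qed.

Lemma not_paraboloid_ellipsoid S : n = 1%N \/ (2 < n)%N ->
  is_paraboloid S -> ~ is_ellipsoid S.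
Proof.
move=> n13 pS /ellipsoid_bounded; case: n13 => n1.
  by case: (paraboloid_dim_neq1 pS n1).
exact: paraboloid_unbounded.
Qed.

Lemma not_paraboloid_hyperboloid S : n = 1%N \/ (2 < n)%N ->
  is_paraboloid S -> ~ is_hyperboloid S.
Proof.
move=> n13 pS hS; case: n13 => n1.
  exact: paraboloid_dim_neq1 pS n1.
apply: (paraboloid_unbounded n1 pS).
exact: paraboloid_symmetric_bounded (hyperboloid_symmetric hS).
Qed.

End ConicTypes.

(** * Classification by [eps * rho] *)

Theorem corollary14 (R : realType) (n : nat) (hn : n <> 2%N)
  (a c eps : R) (ha : 0 < a) (hac : a < c) (heps : eps = c / a)
  (ctr v : 'cV[R]_n) (hv : enorm v = 1)
  (h : 'cV[R]_n) (hh : enorm h = 1) (hhat : R) (hhat_gt0 : 0 < hhat) :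
  let C := cone ctr v eps in
  let HP := hyperplane h ctr hhat in
  let rho := Num.sqrt (1 - dotv h v ^+ 2) in
  [/\ is_hyperboloid (C `&` HP) <-> 1 < eps * rho,
      is_ellipsoid (C `&` HP) <-> eps * rho < 1
    & is_paraboloid (C `&` HP) <-> eps * rho = 1].
Proof.
move=> C HP rho.
have vv : dotv v v = 1 by rewrite -enorm_sqr hv expr1n.
have h1 : dotv h h = 1 by rewrite -enorm_sqr hh expr1n.
have e1 : 1 < eps by rewrite heps ltr_pdivlMr ?mul1r.
have n_gt0 k (u : 'cV[R]_k) : dotv u u = 1 -> k <> 0%N.
  by case: k u => // u; rewrite /dotv big_ord0 => /eqP; rewrite eq_sym oner_eq0.
have n13 : n = 1%N \/ (2 < n)%N.
  by move: hn (n_gt0 _ _ vv); case: (n) => [|[|[|m]]] //; [left|right].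
(* Cauchy-Schwarz keeps the radicand nonnegative, so the square root is not the default 0 of a
   negative argument. *)
have rho2 : rho ^+ 2 = 1 - dotv h v ^+ 2.
  rewrite sqr_sqrtr // subr_ge0 -[X in _ <= X](mulr1 1).
  by rewrite -{1}h1 -vv dotv_CauchySchwarz.
have er0 : 0 <= eps * rho by rewrite mulr_ge0 ?sqrtr_ge0 //; lra.
have [hyp ell par] : [/\ 1 < eps * rho -> is_hyperboloid (C `&` HP),
    eps * rho < 1 -> is_ellipsoid (C `&` HP)
  & eps * rho = 1 -> is_paraboloid (C `&` HP)].
  have er2 : eps ^+ 2 * (1 - dotv h v ^+ 2) = (eps * rho) ^+ 2.
    by rewrite exprMn rho2.
  have hp : is_hyperplane HP.
    exists h, ctr, hhat; split=> // h0.
    by move/eqP: h1; rewrite h0 -(scale0r 0) dotvZl mul0r eq_sym oner_eq0.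
  have foci m F : HP m -> dotv h F = 0 -> HP (m + F) /\ HP (m - F).
    rewrite /HP /hyperplane /= => Hm hF.
    by move: Hm; rewrite !dotv_lin hF; split; lra.
  split=> er.
  - have k0 : 1 - eps ^+ 2 * (1 - dotv h v ^+ 2) < 0.
      by rewrite er2 subr_lt0 expr_gt1.
    have [m [F [al [Hm hF al0 FF CE]]]] :=
      cone_section_bifocal ctr vv h1 e1 hhat_gt0 (ltr0_neq0 k0).
    have alF : al ^+ 2 < dotv F F.
      rewrite FF ltr_pMl ?exprn_gt0 //; lra.
    exists HP, (m + F), (m - F), al; split=> //; first exact: foci.
      split; first by rewrite mulr_gt0.
      rewrite enorm_focal ltr_pM2l // -ltr_sqr ?nnegrE ?enorm_ge0 ?(ltW al0) //.
      by rewrite enorm_sqr.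
    rewrite {}/C {}CE; apply/seteqP.
    by split=> x /= [Ax /(bifocal_hyperboloid x m F al al0 alF)].
  - have k0 : 0 < 1 - eps ^+ 2 * (1 - dotv h v ^+ 2).
      by rewrite er2 subr_gt0 expr_lt1.
    have [m [F [al [Hm hF al0 FF CE]]]] :=
      cone_section_bifocal ctr vv h1 e1 hhat_gt0 (lt0r_neq0 k0).
    have alF : dotv F F < al ^+ 2.
      rewrite FF gtr_pMl ?exprn_gt0 //; lra.
    exists HP, (m + F), (m - F), al; split=> //; first exact: foci.
      split=> //.
      rewrite enorm_focal ltr_pM2l // -ltr_sqr ?nnegrE ?enorm_ge0 ?(ltW al0) //.
      by rewrite enorm_sqr.
    rewrite {}/C {}CE; apply/seteqP.
    by split=> x /= [Ax /(bifocal_ellipsoid x m F al al0 alF)].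
  - by apply: cone_section_paraboloid; rewrite // er2 er expr1n.
have nHE := @not_hyperboloid_ellipsoid _ _ (C `&` HP) n13.
have nPE := @not_paraboloid_ellipsoid _ _ (C `&` HP) n13.
have nPH := @not_paraboloid_hyperboloid _ _ (C `&` HP) n13.
(* In each case of the trichotomy one type is realized, and exclusivity rules out the other two;
   this yields the converses. *)
have [lt1|gt1|eq1] := ltrgtP (eps * rho) 1.
- have E := ell lt1; split; split=> //; first by move/nHE.
  by move/nPE.
- have H := hyp gt1; split; split=> //; first by move/(nHE H).
  by move/nPH.
- have P := par eq1; split; split=> //; first by move/(nPH P).
  by move/(nPE P).
Qed.
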